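(* For every real $c>0$ and every integer $t\ge 2$ there exists a threshold $N_t=N_t(c)$ such that the following holds. Let $G$ be a finite (not necessarily abelian) group with $|G|=n\ge N_t$, and let $S_0\subseteq\{(a,b,ab): a,b\in G\}\subseteq G^3$ be a set of triples with $|S_0|\ge cn^2$. Then there is an integer $\nu$ with $2^{t+1}\le \nu\le 4^t+3t$ such that $S_0$ contains a $\left(\nu,\ \frac{4(\nu-3t)}{3}\left(1-\frac1{4^t}\right)\right)$-configuration.
   Context: Let $G$ be a finite group and $S\subseteq\{(a,b,ab):a,b\in G\}$. For an integer $m$ and a real number $k$, an $(m,k)$-configuration in $S$ is a set $T\subseteq S$ consisting of at least $k$ distinct triples on $m$ elements of $G$, i.e. such that the set of all elements of $G$ occurring as a coordinate of some triple in $T$ has exactly $m$ elements. (Coordinates are regarded as elements of the single set $G$.) *)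

(* Defs.v *)
From mathcomp Require Export all_boot all_order all_algebra all_fingroup.
From mathcomp Require Export reals.

Set Implicit Arguments.
Unset Strict Implicit.
Unset Printing Implicit Defensive.

Import Order.TTheory GRing.Theory Num.Theory.
Local Open Scope ring_scope.

Definition mul_triples (gT : finGroupType) : {set gT * gT * gT} :=
  [set (a, b, (a * b)%g) | a : gT, b : gT].

(* The three coordinates are pooled in the single set gT, so an element that
   occurs in several positions, or in several triples, counts once. *)
Definition coords (gT : finGroupType) (T : {set gT * gT * gT}) : {set gT} :=
  [set s.1.1 | s in T] :|: [set s.1.2 | s in T] :|: [set s.2 | s in T].

Definition is_configuration (R : realType) (gT : finGroupType) (m : nat) (k : R)
    (T : {set gT * gT * gT}) : Prop :=
  #|coords T| = m /\ k <= #|T|%:R.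

Definition has_configuration (R : realType) (gT : finGroupType) (m : nat) (k : R)
    (S : {set gT * gT * gT}) : Prop :=
  exists2 T : {set gT * gT * gT}, T \subset S & is_configuration m k T.

(* Main.v *)
(** The maps (a,b,c) -> (ga,b,gc), (a,bg,cg) and (ag,g^-1 b,c) preserve
    multiplication triples, and each fixes one coordinate. For a dense set X of
    triples, Cauchy-Schwarz over the fibres of the fixed coordinate gives a g
    whose shift maps a dense part of X into X; repeating this with all three
    kinds of shift, r = t-1 times each, produces an orbit of 8^r triples in S0
    whose i-th coordinates take at most 4^r values, because the shifts fixing
    that coordinate do not create new ones. This has at most 3 * 4^(t-1) points
    and the required 8^(t-1) triples; if it has too few points, adding
    arbitrary triples of S0 one at a time repairs that. *)
Require Import Defs.
From mathcomp Require Import lra zify.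
Import Order.TTheory GRing.Theory Num.Theory.
Local Open Scope ring_scope.

Set Implicit Arguments.
Unset Strict Implicit.
Unset Printing Implicit Defensive.

(* Every base triple x in X generates k triples tau x of S. The bound on the
   fibres of tau ensures that only boundedly many shifts g make tau x and
   tau (shift x) overlap; A, B and C exist because each coordinate of a
   generated triple depends only on the same coordinate of x. *)
Definition pattern (gT : finGroupType) (S X : {set gT * gT * gT})
    (k i j l : nat) : Prop :=
  exists (tau : gT * gT * gT -> {set gT * gT * gT}) (A B C : gT -> {set gT}),
  [/\ forall x, x \in X -> tau x \subset S /\ #|tau x| = k,
      forall u, (#|[set x | u \in tau x]| <= k)%N,
      forall x u, u \in tau x ->
        [/\ u.1.1 \in A x.1.1, u.1.2 \in B x.1.2 & u.2 \in C x.2]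
    & forall a, [/\ #|A a| <= i, #|B a| <= j & #|C a| <= l]%N].

(** * Cauchy-Schwarz and the doubling of a pattern by one shift *)

(** Cauchy-Schwarz for the fibre sizes [d a] of [p] on [X]: they add up to [#|X|], and the sum on
    the right is that of their squares. It follows from $2 d_a d_b \le d_a^2 + d_b^2$ summed over
    all pairs. *)
Lemma sqr_sum_card_le (T I : finType) (p : T -> I) (X : {set T}) :
  (#|X| ^ 2 <= #|I| * \sum_(x in X) #|[set y in X | p y == p x]|)%N.
Proof.
pose d a := #|[set y in X | p y == a]|.
have dE : (\sum_(x in X) #|[set y in X | p y == p x]| = \sum_a d a * d a)%N.
  rewrite (partition_big p predT) //=; apply: eq_bigr => a _.
  rewrite (eq_bigr (fun=> d a)) => [|x /andP[_ /eqP ->] //].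
  rewrite sum_nat_const; congr (_ * _)%N.
  by rewrite /d; apply: eq_card => y; rewrite !inE.
have XE : (#|X| = \sum_a d a)%N.
  rewrite -sum1_card (partition_big p predT) //=; apply: eq_bigr => a _.
  by rewrite sum1_card /d; apply: eq_card => y; rewrite !inE.
rewrite dE XE -leq_double -!mul2n -mulnn.
rewrite -[X in (2 * (X * _))%N]/(\sum_a d a)%N big_distrlr big_distrr /=.
have -> : (2 * (#|I| * \sum_a d a * d a) =
    \sum_a \sum_b (d a * d a + d b * d b))%N.
  rewrite [RHS](eq_bigr (fun a => #|I| * (d a * d a) + \sum_b d b * d b)%N).
    by rewrite big_split /= -big_distrr sum_nat_const mul2n -addnn.
  by move=> a _; rewrite big_split /= sum_nat_const.
apply: leq_sum => a _; rewrite big_distrr; apply: leq_sum => b _ /=.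
by have := nat_Cauchy (d a) (d b); rewrite -!mulnn => ->.
Qed.

Definition shift (gT : finGroupType) (al be ka : gT -> gT -> gT) (g : gT)
    (x : gT * gT * gT) : gT * gT * gT :=
  (al g x.1.1, be g x.1.2, ka g x.2).

(** Joining the triples generated by [x] and by its shift turns [A a] into [A a :|: A (f g a)]; [i']
    is the new bound, equal to [i] if [f] fixes the coordinate and to [2 * i] in general. *)
Definition orbit_bound (gT : finGroupType) (f : gT -> gT -> gT) (i i' : nat) :=
  forall (A : gT -> {set gT}) g a,
    (forall b, #|A b| <= i)%N -> (#|A a :|: A (f g a)| <= i')%N.

(** For a suitable [g] the new generator is [tau x :|: tau (sh g x)], restricted to those [x] for
    which both parts are available and disjoint. The density falls from $1/q$ to $1/(2q^2)$, where
    [q] stands for an inverse density. *)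
Lemma pattern_shift (gT : finGroupType) (al be ka : gT -> gT -> gT)
    (p : gT * gT * gT -> gT) (i j l i' j' l' q k : nat)
    (S X : {set gT * gT * gT}) (sh := shift al be ka) :
  (forall x, injective (sh^~ x)) -> (forall g, injective (sh g)) ->
  (forall x y, x \in mul_triples gT -> y \in mul_triples gT ->
     p x = p y -> exists g, y = sh g x) ->
  orbit_bound al i i' -> orbit_bound be j j' -> orbit_bound ka l l' ->
  (2 * k ^ 2 * q <= #|gT|)%N -> X \subset mul_triples gT ->
  (#|gT| ^ 2 <= q * #|X|)%N -> pattern S X k i j l ->
  exists2 X' : {set gT * gT * gT}, X' \subset X &
    (#|gT| ^ 2 <= 2 * q ^ 2 * #|X'|)%N /\ pattern S X' (2 * k) i' j' l'.
Proof.
move=> sh_inj sh_bij sh_trans alP beP kaP n_large X_mul X_dense.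
move=> [tau [A [B [C [tauX tau_fib tau_crd crd_card]]]]].
pose Y g := [set x in X | (sh g x \in X) && [disjoint tau x & tau (sh g x)]].
have mulX z : z \in X -> z \in mul_triples gT by apply: (subsetP X_mul).
have n_gt0 : (0 < #|gT|)%N by apply/card_gt0P; exists 1%g.
have shifts_ge x : x \in X ->
    (#|[set y in X | p y == p x]| <=
       #|[set g | x \in Y g]| + k ^ 2)%N.
  (* Each of the [k] triples [u] in [tau x] lies in [tau y] for at most [k] triples [y], and each
     [y] is [sh g x] for at most one [g]. *)
  move=> xX; pose bad := \bigcup_(u in tau x) [set g | u \in tau (sh g x)].
  have bad_le : (#|bad| <= k ^ 2)%N.
    have [_ tau_k] := tauX x xX.
    rewrite (leq_trans (_ : (_ <= \sum_(u in tau x) k)%N)) //; last first.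
      by rewrite sum_nat_const tau_k mulnn.
    rewrite /bad; elim/big_ind2 : _ => [|m D m' D' h h'|u _].
    - by rewrite cards0.
    - by rewrite (leq_trans (leq_card_setU _ _)) // leq_add.
    - apply: leq_trans (tau_fib u); rewrite -(card_imset _ (@sh_inj x)).
      by apply/subset_leq_card/subsetP => _ /imsetP[g + ->]; rewrite !inE.
  apply: (@leq_trans #|[set g | x \in Y g] :|: bad|); last first.
    by rewrite (leq_trans (leq_card_setU _ _)) // leq_add2l.
  rewrite -(card_imset _ (@sh_inj x)); apply/subset_leq_card/subsetP => y.
  rewrite inE => /andP[yX /eqP pyx].
  have [g yE] := sh_trans x y (mulX x xX) (mulX y yX) (esym pyx).
  rewrite yE; apply: imset_f; rewrite !inE xX -yE yX /=.
  case: (boolP [disjoint _ & _]) => //= /pred0Pn[u /andP[ux uy]].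
  by apply/bigcupP; exists u => //; rewrite inE -yE.
(* A [g] with [#|Y g|] maximal does at least as well as the average over all shifts. *)
have [g Yg] : exists g, (#|X| ^ 2 <= #|gT| * (#|gT| * #|Y g| + k ^ 2 * #|X|))%N.
  have [g _ g_max] := @arg_maxnP _ (1%g : gT) predT (fun g => #|Y g|) isT.
  exists g; apply: leq_trans (sqr_sum_card_le p X) _.
  rewrite leq_mul2l; apply/orP; right.
  rewrite (leq_trans (leq_sum _ shifts_ge)) // big_split /= sum_nat_const.
  rewrite [X in (_ + X)%N]mulnC leq_add2r.
  have -> : (\sum_(x in X) #|[set h | x \in Y h]| = \sum_h #|Y h|)%N.
    rewrite (eq_bigr (fun x => \sum_h (x \in Y h))%N) => [|x _]; last first.
      rewrite -sum1_card big_mkcond; apply: eq_bigr => h _.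
      by rewrite inE; case: ifP.
    rewrite exchange_big; apply: eq_bigr => h _ /=.
    rewrite -sum1_card [RHS]big_mkcond [LHS]big_mkcond /=.
    by apply: eq_bigr => x _; rewrite !inE; case: (x \in X) => //=; case: ifP.
  by rewrite -sum_nat_const; apply: leq_sum => h _; exact: g_max.
exists (Y g); first by apply/subsetP => x; rewrite inE => /andP[].
split.
  have q_gt0 : (0 < q)%N by nia.
  move: #|gT| #|X| #|Y g| X_dense n_large n_gt0 Yg => n x y h1 h2 h3 h4.
  (* The overlap term is thus at most half of $x^2$, which leaves $x^2 \le 2n^2y$; with $n^2 \le qx$
     this gives $n^4 \le 2q^2n^2y$. *)
  have kn : (2 * (k ^ 2 * n) <= x)%N.
    rewrite -(leq_pmul2l q_gt0); apply: leq_trans h1.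
    by rewrite -mulnn; nia.
  have h5 : (x ^ 2 <= 2 * (n ^ 2 * y))%N by nia.
  have h6 : (n ^ 2 * n ^ 2 <= (q * x) * (q * x))%N by rewrite leq_mul.
  rewrite -(@leq_pmul2l (n ^ 2)) ?expn_gt0 ?h3 //.
  by apply: (leq_trans h6); nia.
exists (fun x => tau x :|: tau (sh g x)), (fun a => A a :|: A (al g a)),
  (fun b => B b :|: B (be g b)), (fun c => C c :|: C (ka g c)); split.
- move=> x; rewrite inE => /and3P[/tauX[sub1 k1] /tauX[sub2 k2] dis].
  rewrite subUset sub1 sub2 cardsU k1 k2.
  by move: dis; rewrite -setI_eq0 => /eqP ->; rewrite cards0 subn0 addnn mul2n.
- move=> u; rewrite mul2n -addnn.
  apply: (@leq_trans #|[set x | u \in tau x] :|: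
      sh g @^-1: [set x | u \in tau x]|).
    by apply/subset_leq_card/subsetP => x; rewrite !inE.
  rewrite (leq_trans (leq_card_setU _ _)) // leq_add //.
  apply: leq_trans (tau_fib u); rewrite -(card_imset _ (@sh_bij g)).
  by apply/subset_leq_card/subsetP => _ /imsetP[x + ->]; rewrite !inE.
- move=> x u; rewrite inE => /orP[] /tau_crd[h1 h2 h3].
    by rewrite !inE h1 h2 h3.
  by rewrite !inE; split; apply/orP; right.
- by move=> a; split; [apply: alP|apply: beP|apply: kaP] => b;
    have [] := crd_card b.
Qed.

(** * The three kinds of shift and their iteration *)

Lemma orbit_bound_double (gT : finGroupType) (f : gT -> gT -> gT) i :
  orbit_bound f i (2 * i).
Proof.
move=> A g a Ai; rewrite mul2n -addnn.
by rewrite (leq_trans (leq_card_setU _ _)) // leq_add.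
Qed.

Lemma orbit_bound_id (gT : finGroupType) i :
  orbit_bound (fun _ a : gT => a) i i.
Proof. by move=> A g a Ai; rewrite setUid. Qed.

(** Each kind of shift is used once. Every coordinate is moved by exactly two of the three, so its
    bound grows by 4 while the number of triples grows by 8. *)
Lemma pattern_shift3 (gT : finGroupType) (i j l q k : nat)
    (S X : {set gT * gT * gT}) (q1 := (2 * q ^ 2)%N) (q2 := (2 * q1 ^ 2)%N) :
  (2 * k ^ 2 * q <= #|gT|)%N -> (2 * (2 * k) ^ 2 * q1 <= #|gT|)%N ->
  (2 * (2 * (2 * k)) ^ 2 * q2 <= #|gT|)%N ->
  X \subset mul_triples gT -> (#|gT| ^ 2 <= q * #|X|)%N ->
  pattern S X k i j l ->
  exists2 X' : {set gT * gT * gT}, X' \subset mul_triples gT &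
    (#|gT| ^ 2 <= 2 * q2 ^ 2 * #|X'|)%N /\
    pattern S X' (8 * k) (4 * i) (4 * j) (4 * l).
Proof.
move=> n0 n1 n2 X_mul X_dense X_pat.
have mulP (x : gT * gT * gT) : x \in mul_triples gT -> x.2 = (x.1.1 * x.1.2)%g.
  by case/imset2P => a b _ _ ->.
have [X1 X1X [X1_dense X1_pat]] :
    exists2 X1 : {set gT * gT * gT}, X1 \subset X &
    (#|gT| ^ 2 <= q1 * #|X1|)%N /\
    pattern S X1 (2 * k) (2 * i) j (2 * l).
  apply: (@pattern_shift _ (fun g a => g * a)%g (fun _ b => b)
    (fun g c => g * c)%g (fun x => x.1.2) i j l) => //.
  - by move=> x g h [/mulIg].
  - by move=> g [[a b] c] [[a' b'] c'] [/mulgI -> -> /mulgI ->].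
  - move=> [[a b] c] [[a' b'] c'] /mulP /= -> /mulP /= -> <-.
    by exists (a' * a^-1)%g; rewrite /shift /= mulgA mulgKV.
  - exact: orbit_bound_double.
  - exact: orbit_bound_id.
  - exact: orbit_bound_double.
have X1_mul := subset_trans X1X X_mul.
have [X2 X2X1 [X2_dense X2_pat]] :
    exists2 X2 : {set gT * gT * gT}, X2 \subset X1 &
    (#|gT| ^ 2 <= q2 * #|X2|)%N /\
    pattern S X2 (2 * (2 * k)) (2 * i) (2 * j) (2 * (2 * l)).
  apply: (@pattern_shift _ (fun _ a => a) (fun g b => b * g)%g
    (fun g c => c * g)%g (fun x => x.1.1) (2 * i)%N j (2 * l)%N) => //.
  - by move=> x g h [/mulgI].
  - by move=> g [[a b] c] [[a' b'] c'] [-> /mulIg -> /mulIg ->].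
  - move=> [[a b] c] [[a' b'] c'] /mulP /= -> /mulP /= -> <-.
    by exists (b^-1 * b')%g; rewrite /shift /= -mulgA !mulKVg.
  - exact: orbit_bound_id.
  - exact: orbit_bound_double.
  - exact: orbit_bound_double.
have X2_mul := subset_trans X2X1 X1_mul.
have [X3 X3X2 [X3_dense X3_pat]] :
    exists2 X3 : {set gT * gT * gT}, X3 \subset X2 &
    (#|gT| ^ 2 <= 2 * q2 ^ 2 * #|X3|)%N /\
    pattern S X3 (2 * (2 * (2 * k))) (2 * (2 * i)) (2 * (2 * j)) (2 * (2 * l)).
  apply: (@pattern_shift _ (fun g a => a * g)%g (fun g b => g^-1 * b)%g
    (fun _ c => c) (fun x => x.2) (2 * i)%N (2 * j)%N (2 * (2 * l))%N) => //.
  - by move=> x g h [/mulgI].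
  - by move=> g [[a b] c] [[a' b'] c'] [/mulIg -> /mulgI -> ->].
  - move=> [[a b] c] [[a' b'] c'] /mulP /= -> /mulP /= -> ab.
    exists (a^-1 * a')%g; rewrite /shift /= mulKVg invMg invgK -mulgA ab.
    by rewrite mulKg.
  - exact: orbit_bound_double.
  - exact: orbit_bound_double.
  - exact: orbit_bound_id.
exists X3; first exact: subset_trans X3X2 X2_mul.
by split=> //; move: X3_pat; rewrite !mulnA.
Qed.

(** Induction on [r], starting from singletons. [N] and [q'] are chosen before the group, which
    makes the final threshold uniform. *)
Lemma pattern_exists (r q : nat) : exists N q' : nat,
  forall (gT : finGroupType) (S : {set gT * gT * gT}),
    (N <= #|gT|)%N -> S \subset mul_triples gT -> (#|gT| ^ 2 <= q * #|S|)%N ->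
    exists2 X : {set gT * gT * gT}, X \subset mul_triples gT &
      (#|gT| ^ 2 <= q' * #|X|)%N /\ pattern S X (8 ^ r) (4 ^ r) (4 ^ r) (4 ^ r).
Proof.
elim: r => [|r [N [q' IH]]].
  exists 0%N, q => gT S _ S_mul S_dense; exists S => //; split=> //.
  exists set1, set1, set1, set1; split.
  - by move=> x xS; rewrite sub1set xS cards1.
  - move=> u; rewrite -[X in (_ <= X)%N](cards1 u).
    by apply/subset_leq_card/subsetP => x; rewrite !inE eq_sym.
  - by move=> x u /set1P ->; rewrite !set11.
  - by move=> a; rewrite !cards1.
pose q1 := (2 * q' ^ 2)%N; pose q2 := (2 * q1 ^ 2)%N; pose k := (8 ^ r)%N.
exists (N + (2 * k ^ 2 * q' + (2 * (2 * k) ^ 2 * q1 +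
  2 * (2 * (2 * k)) ^ 2 * q2)))%N, (2 * q2 ^ 2)%N => gT S.
move=> n_large S_mul S_dense; rewrite !(expnS _ r).
have [N_le n0 n1 n2] : [/\ N <= #|gT|, 2 * k ^ 2 * q' <= #|gT|,
    2 * (2 * k) ^ 2 * q1 <= #|gT| & 2 * (2 * (2 * k)) ^ 2 * q2 <= #|gT|]%N.
  move: n_large; move: (_ * q')%N (_ * q1)%N (_ * q2)%N => n0 n1 n2 n_large.
  by split; lia.
have [X X_mul [X_dense X_pat]] := IH gT S N_le S_mul S_dense.
exact: (@pattern_shift3 _ _ _ _ q' k S X).
Qed.

(** * Padding a set of triples up to a prescribed number of coordinates *)

Lemma coordsP (gT : finGroupType) (T : {set gT * gT * gT}) a :
  reflect (exists2 x, x \in T & [|| a == x.1.1, a == x.1.2 | a == x.2])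
    (a \in coords T).
Proof.
apply: (iffP idP) => [|[x xT]].
  by rewrite !inE => /orP[/orP[]|] /imsetP[x xT ->];
    exists x; rewrite ?eqxx ?orbT.
rewrite !inE => /or3P[] /eqP ->; apply/orP; [left|left|right];
  last exact: imset_f.
- by apply/orP; left; exact: (imset_f (fun x => x.1.1)).
- by apply/orP; right; exact: (imset_f (fun x => x.1.2)).
Qed.

Lemma card_coordsU1 (gT : finGroupType) (x : gT * gT * gT)
    (T : {set gT * gT * gT}) : (#|coords (x |: T)| <= #|coords T| + 3)%N.
Proof.
apply: (@leq_trans #|coords T :|: [set x.1.1; x.1.2; x.2]|).
  apply/subset_leq_card/subsetP => a /coordsP[y /setU1P[->|yT] ay].
    by rewrite !(in_setU, in_set1) -!orbA ay !orbT.
  by rewrite in_setU; apply/orP; left; apply/coordsP; exists y.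
rewrite (leq_trans (leq_card_setU _ _)) // leq_add2l.
by rewrite -setUA !cardsU1 cards1; do 2 case: (_ \notin _).
Qed.

(** Take [T'] of maximal size with at most [M] coordinates. If it had fewer than [m], one more
    triple would give at most $m - 1 + 3 \le M$, so [T'] would be all of [S]; but then [S] lies in
    the cube of fewer than [m] elements, against [m ^ 3 < #|S|]. *)
Lemma coords_padding (gT : finGroupType) (m M : nat)
    (S T : {set gT * gT * gT}) :
  T \subset S -> (#|coords T| <= M)%N -> (m + 2 <= M)%N -> (m ^ 3 < #|S|)%N ->
  exists2 T' : {set gT * gT * gT}, T \subset T' /\ T' \subset S &
    (m <= #|coords T'| <= M)%N.
Proof.
move=> TS TM mM Sm.
pose P (U : {set gT * gT * gT}) :=
  [&& T \subset U, U \subset S & #|coords U| <= M]%N.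
have PT : P T by rewrite /P subxx TS.
have [T' /and3P[TT' T'S T'M] T'_max] :=
  @arg_maxnP _ T P (fun U => #|U|) PT.
exists T' => //; rewrite T'M andbT leqNgt; apply/negP => T'm.
have ST' : S \subset T'.
  apply/subsetP => x xS; case: (boolP (x \in T')) => // xT'.
  have : P (x |: T').
    rewrite /P subUset sub1set xS T'S (subset_trans TT') ?subsetUr //=.
    by apply: leq_trans (card_coordsU1 x T') _; lia.
  by move/T'_max; rewrite /= cardsU1 xT' add1n ltnn.
have : (#|S| <= #|coords T'| ^ 3)%N.
  rewrite !expnS expn0 muln1 mulnA -!cardsX.
  apply/subset_leq_card/subsetP => -[[a b] e] /(subsetP ST') xT'.
  rewrite !in_setX -andbA.
  by apply/and3P; split; apply/coordsP; exists (a, b, e); rewrite ?eqxx ?orbT.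
apply/negP; rewrite -ltnNge; apply: leq_trans Sm.
by rewrite ltnS leq_exp2r // ltnW.
Qed.

(** * Extraction of the configuration and the final count *)

Lemma pattern_config (gT : finGroupType) (S X : {set gT * gT * gT}) k i j l x :
  pattern S X k i j l -> x \in X ->
  exists2 T : {set gT * gT * gT}, T \subset S &
    #|T| = k /\ (#|coords T| <= i + j + l)%N.
Proof.
move=> [tau [A [B [C [tauX _ tau_crd crd_card]]]]] xX.
have [tauS tau_k] := tauX x xX; exists (tau x) => //; split=> //.
have [Ai _ _] := crd_card x.1.1; have [_ Bj _] := crd_card x.1.2.
have [_ _ Cl] := crd_card x.2.
apply: (@leq_trans #|A x.1.1 :|: B x.1.2 :|: C x.2|).
  by rewrite subset_leq_card // !setUSS //; apply/subsetP => _ /imsetP[u + ->];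
    case/tau_crd.
rewrite (leq_trans (leq_card_setU _ _)) // leq_add //.
by rewrite (leq_trans (leq_card_setU _ _)) // leq_add.
Qed.

(** For $t \ge 3$ the left side is at most $4\nu/3 \le 4^t \le 8^{t-1}$. The last inequality fails
    at $t = 2$, where direct evaluation gives at most $15/2 < 8$. *)
Lemma config_count_le (R : realFieldType) (t nu : nat) :
  (2 <= t)%N -> (nu <= 3 * 4 ^ t.-1)%N ->
  4 * (nu%:R - 3 * t%:R) / 3 * (1 - 1 / 4 ^+ t) <= (8 ^ t.-1)%:R :> R.
Proof.
case: t => [|[|[|r]]] // _ nu_le /=.
  have : nu%:R <= 12 :> R by rewrite (ler_nat R nu 12).
  by rewrite !exprS expr0; lra.
have h1 : nu%:R <= 3 * 4 ^+ r.+2 :> R by rewrite -natrX -natrM ler_nat.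
have h2 : 4 * 4 ^+ r.+2 <= (8 ^ r.+2)%:R :> R.
  rewrite -natrX -natrM ler_nat (_ : 8 = 2 * 4)%N // expnMn leq_mul2r.
  by rewrite (@leq_exp2l 2 2) ?orbT.
have e0 : 0 <= 1 / 4 ^+ r.+3 :> R by rewrite divr_ge0 // exprn_ge0.
have e1 : 1 / 4 ^+ r.+3 <= 1 :> R.
  by rewrite ler_pdivrMr ?exprn_gt0 // mul1r exprn_ege1 // ler1n.
have n0 : 0 <= nu%:R :> R by [].
have t0 : 0 <= r.+3%:R :> R by [].
move: (1 / _) e0 e1 => e e0 e1.
apply: le_trans h2; apply: le_trans (_ : 4 * nu%:R / 3 <= _); last by lra.
by nra.
Qed.

Theorem corollary4 (R : realType) (c : R) (hc : 0 < c) (t : nat) (ht : (2 <= t)%N) :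
  exists N : nat,
    forall (gT : finGroupType) (S0 : {set gT * gT * gT}),
      (N <= #|[set: gT]|)%N ->
      S0 \subset mul_triples gT ->
      c * #|[set: gT]|%:R ^+ 2 <= #|S0|%:R ->
      exists nu : nat,
        (2 ^ t.+1 <= nu <= 4 ^ t + 3 * t)%N /\
        has_configuration nu
          (4 * (nu%:R - 3 * t%:R) / 3 * (1 - 1 / 4 ^+ t) : R) S0.
Proof.
(* An integer above $1/c$, so that the density hypothesis can be stated in natural numbers. *)
pose q := Num.bound c^-1; pose m := (2 ^ t.+1)%N.
have [N [q' patP]] := pattern_exists t.-1 q.
(* The summand [q * m ^ 3 + 1] forces [m ^ 3 < #|S0|], which the padding needs. *)
exists (N + q * m ^ 3 + 1)%N => gT S0; rewrite cardsT => n_large S0_mul S0_dense.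
have gT_gt0 : (0 < #|gT|)%N by apply: leq_trans n_large; rewrite addn1.
have S0_dense' : (#|gT| ^ 2 <= q * #|S0|)%N.
  rewrite -(ler_nat R) natrX natrM.
  apply: le_trans (_ : c^-1 * #|S0|%:R <= _); first by rewrite ler_pdivlMl.
  by rewrite ler_wpM2r // ltW // archi_boundP // invr_ge0 ltW.
have [|X X_mul [X_dense X_pat]] := patP gT S0 _ S0_mul S0_dense'.
  by apply: leq_trans n_large; rewrite -addnA leq_addr.
have [x xX] : exists x, x \in X.
  apply/set0Pn; apply: contraTneq X_dense => ->.
  by rewrite cards0 muln0 -ltnNge expn_gt0 gT_gt0.
have [T TS [T_card T_crd]] := pattern_config X_pat xX.
have T_crd' : (#|coords T| <= 3 * 4 ^ t.-1)%N by lia.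
have m_le : (m + 2 <= 3 * 4 ^ t.-1)%N.
  (* With $y = 2^{t-2} \ge 1$ the claim reads $8y + 2 \le 12y^2$. *)
  rewrite /m -(subnK ht) [(t - 2 + 2)%N]addn2 /= (_ : 4 = 2 * 2)%N // expnMn !expnS.
  have : (0 < 2 ^ (t - 2))%N by rewrite expn_gt0.
  by move: (2 ^ _)%N => y; nia.
have S0_large : (m ^ 3 < #|S0|)%N.
  have : (q * m ^ 3 < q * #|S0|)%N.
    apply: leq_trans S0_dense'; apply: leq_trans (leq_pmull _ gT_gt0).
    by apply: leq_trans n_large; rewrite -addnA addn1 leq_addl.
  by rewrite ltn_mul2l => /andP[].
have [T' [TT' T'S] /andP[T'_ge T'_le]] := coords_padding TS T_crd' m_le S0_large.
exists #|coords T'|; split.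
  rewrite T'_ge (leq_trans T'_le) // (leq_trans _ (leq_addr _ _)) //.
  by rewrite -[X in (_ <= 4 ^ X)%N](ltn_predK ht) expnS leq_mul2r orbT.
(* The required count is at most $8^{t-1}$ for every admissible $\nu$, so padding cannot spoil
   it. *)
exists T' => //; split=> //; apply: le_trans (config_count_le R ht T'_le) _.
by rewrite ler_nat -T_card subset_leq_card.
Qed.
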